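(* Let $\mathcal{V}=\oplus_{i\in\mathbb{Z}}\mathcal{V}_i$ be a graded $\mathbb{C}[\partial]$-module. A collection of degree $-1$ conformal sesquilinear maps $\{\rho_k:\mathcal{V}^{\otimes k}\to\mathcal{V}[\lambda_1,\ldots,\lambda_{k-1}]\}_{k\ge1}$ makes the pair $(\mathcal{V},\{\rho_k\}_{k\ge1})$ into an $A_\infty[1]$-conformal algebra if and only if the element $\rho=\sum_{k\ge1}\rho_k\in C^{-1}_{cs}(\mathcal{V})$ is a Maurer-Cartan element in the graded Lie algebra $(C^\bullet_{cs}(\mathcal{V}),[\![\ ,\ ]\!])$, i.e. $[\![\rho,\rho]\!]=0$.
   Context: All vector spaces, linear maps and tensor products are over $\mathbb{C}$. A graded $\mathbb{C}[\partial]$-module is $\mathcal{V}=\oplus_{i\in\mathbb{Z}}\mathcal{V}_i$ with each $\mathcal{V}_i$ a $\mathbb{C}[\partial]$-module; $|v|$ is the degree of a homogeneous $v$; $\mathcal{V}[\lambda_1,\ldots,\lambda_{k-1}]$ is graded by $\mathcal{V}_i[\lambda_1,\ldots,\lambda_{k-1}]$, with $\partial$ acting coefficientwise. A $\mathbb{C}$-linear map $\varphi:\mathcal{V}^{\otimes k}\to\mathcal{V}[\lambda_1,\ldots,\lambda_{k-1}]$ is conformal sesquilinear if $\varphi_{\lambda_1,\ldots,\lambda_{k-1}}(v_1,\ldots,\partial v_i,\ldots,v_k)=-\lambda_i\,\varphi_{\lambda_1,\ldots,\lambda_{k-1}}(v_1,\ldots,v_k)$ for $1\le i\le k-1$, and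 $\varphi_{\lambda_1,\ldots,\lambda_{k-1}}(v_1,\ldots,v_{k-1},\partial v_k)=(\partial+\lambda_1+\cdots+\lambda_{k-1})\varphi_{\lambda_1,\ldots,\lambda_{k-1}}(v_1,\ldots,v_k)$. Maps are extended linearly over polynomials in the $\lambda$'s when composed. An $A_\infty[1]$-conformal algebra is a graded $\mathbb{C}[\partial]$-module $\mathcal{V}$ with degree $-1$ conformal sesquilinear maps $\rho_k:\mathcal{V}^{\otimes k}\to\mathcal{V}[\lambda_1,\ldots,\lambda_{k-1}]$, $k\ge1$, such that for all $n\ge1$ and homogeneous $v_1,\ldots,v_n$, $$\sum_{k+l=n+1}\sum_{i=1}^k(-1)^{|v_1|+\cdots+|v_{i-1}|}(\rho_k)_{\lambda_1,\ldots,\lambda_{i-1},\lambda_i+\cdots+\lambda_{i+l-1},\lambda_{i+l},\ldots,\lambda_{n-1}}\big(v_1,\ldots,v_{i-1},(\rho_l)_{\lambda_i,\ldots,\lambda_{i+l-2}}(v_i,\ldots,v_{i+l-1}),v_{i+l},\ldots,v_n\big)=0,$$ where for $i=k$ the subscripts of $\rho_k$ are just $\lambda_1,\ldots,\lambda_{k-1}$. $\mathrm{Hom}^n_{cs}(\mathcal{V}^{\otimes k},\mathcal{V}[\lambda_1,\ldots,\lambda_{k-1}])$ denotes the degree $n$ conformal sesquilinear maps, $C^n_{cs}(\mathcal{V})=\prod_{k\ge1}\mathrm{Hom}^n_{cs}(\mathcal{V}^{\otimes k},\mathcal{V}[\lambda_1,\ldots,\lambda_{k-1}])$ (elements written $\sum_{k\ge1}\rho_k$),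 and $C^\bullet_{cs}(\mathcal{V})=\oplus_nC^n_{cs}(\mathcal{V})$. For $\rho\in C^n_{cs}(\mathcal{V})$, $\varrho\in C^m_{cs}(\mathcal{V})$, $$[\![\rho,\varrho]\!]=\sum_{p\ge1}\sum_{k+l=p+1}(\rho_k\diamond\varrho_l-(-1)^{mn}\varrho_l\diamond\rho_k),$$ where $$(\rho_k\diamond\varrho_l)_{\lambda_1,\ldots,\lambda_{p-1}}(v_1,\ldots,v_p)=\sum_{i=1}^k(-1)^{m(|v_1|+\cdots+|v_{i-1}|)}(\rho_k)_{\lambda_1,\ldots,\lambda_{i-1},\lambda_i+\cdots+\lambda_{i+l-1},\lambda_{i+l},\ldots,\lambda_{p-1}}\big(v_1,\ldots,v_{i-1},(\varrho_l)_{\lambda_i,\ldots,\lambda_{i+l-2}}(v_i,\ldots,v_{i+l-1}),v_{i+l},\ldots,v_p\big).$$ This bracket makes $C^\bullet_{cs}(\mathcal{V})$ a graded Lie algebra. *)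

(* Defs.v *)
From HB Require Import structures.
From mathcomp Require Import all_boot all_order all_algebra.
From mathcomp Require Import finmap boolp functions zify.
From mathcomp.multinomials Require Import monalg.

Set Implicit Arguments.
Unset Strict Implicit.
Unset Printing Implicit Defensive.

Import GRing.Theory.
Local Open Scope fset_scope.
Local Open Scope ring_scope.

(* V[λ_0, ..., λ_(n-1)]: finitely supported families of coefficients in V,     *)
(* indexed by the monomials in n variables.                                   *)
Definition vpoly (K : fieldType) (V : lmodType K) (n : nat) : Type :=
  {malg V['X_{1..n}]}.

HB.instance Definition _ (K : fieldType) (V : lmodType K) n :=
  GRing.Zmodule.on (@vpoly K V n).

HB.lock Definition vmon (K : fieldType) (V : lmodType K) (n : nat)
    (v : V) (m : 'X_{1..n}) : vpoly V n := << v *g m >>.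
Arguments vmon {K V n}.

Definition vconst {K : fieldType} {V : lmodType K} {n} (v : V) : vpoly V n :=
  vmon v mone.

HB.lock Definition vscale (K : fieldType) (V : lmodType K) (n : nat)
    (q : {mpoly K[n]}) (P : vpoly V n) : vpoly V n :=
  \sum_(m1 <- msupp q) \sum_(m2 <- msupp P)
    vmon (q@_m1 *: P@_m2) (mmul m1 m2).
Arguments vscale {K V n}.

Section VPoly.
Context {K : fieldType} {V : lmodType K} {n : nat}.
Implicit Types (q : {mpoly K[n]}) (P : vpoly V n) (v w : V).
Implicit Types (m : 'X_{1..n}) (d : {fset 'X_{1..n}}).

Lemma vmonD v w m : vmon (v + w) m = vmon v m + vmon w m :> vpoly V n.
Proof. by rewrite vmon.unlock; exact: monalgUD. Qed.

Lemma vmon0 m : vmon 0 m = 0 :> vpoly V n.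
Proof. by rewrite vmon.unlock; exact: monalgU0. Qed.

Lemma mcoeff_vmon v m m' : (vmon v m : vpoly V n)@_m' = v *+ (m == m').
Proof. by rewrite vmon.unlock mcoeffU. Qed.

Lemma vpolyE P : P = \sum_(m <- msupp P) vmon P@_m m.
Proof. by rewrite vmon.unlock; exact: monalgE. Qed.

Lemma vpoly_ind (Q : vpoly V n -> Prop) :
  Q 0 -> (forall P P', Q P -> Q P' -> Q (P + P')) ->
  (forall v m, Q ((vmon v m : vpoly V n))) -> forall P, Q P.
Proof. by move=> Q0 QD QU P; rewrite [P]vpolyE; elim/big_ind: _. Qed.

Lemma vscalew d1 d2 q P : msupp q `<=` d1 -> msupp P `<=` d2 ->
  vscale q P =
  \sum_(m1 <- d1) \sum_(m2 <- d2) vmon (q@_m1 *: P@_m2) (mmul m1 m2).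
Proof.
move=> le1 le2; rewrite vscale.unlock (big_fset_incl _ le1) /=.
  apply/eq_bigr=> m1 _; apply/big_fset_incl => // m _ /mcoeff_outdom ->.
  by rewrite scaler0 vmon0.
move=> m _ /mcoeff_outdom qm.
by rewrite big1 // => m' _; rewrite qm scale0r vmon0.
Qed.

Lemma vscaleDl q1 q2 P : vscale (q1 + q2) P = vscale q1 P + vscale q2 P.
Proof.
have s1 := fsubsetUl (msupp q1) (msupp q2).
have s2 := fsubsetUr (msupp q1) (msupp q2).
have s3 := msuppD_le q1 q2.
have s0 := fsubset_refl (msupp P).
rewrite (vscalew s3 s0) (vscalew s1 s0) (vscalew s2 s0).
rewrite -big_split /=; apply/eq_bigr=> m1 _.
rewrite -big_split /=; apply/eq_bigr=> m2 _.
by rewrite mcoeffD scalerDl vmonD.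
Qed.

Lemma vscaleDr q P1 P2 : vscale q (P1 + P2) = vscale q P1 + vscale q P2.
Proof.
have s1 := fsubsetUl (msupp P1) (msupp P2).
have s2 := fsubsetUr (msupp P1) (msupp P2).
have s3 := msuppD_le P1 P2.
have s0 := fsubset_refl (msupp q).
rewrite (vscalew s0 s3) (vscalew s0 s1) (vscalew s0 s2).
rewrite -big_split /=; apply/eq_bigr=> m1 _.
rewrite -big_split /=; apply/eq_bigr=> m2 _.
by rewrite mcoeffD scalerDr vmonD.
Qed.

Lemma vscaleUU c v m1 m2 :
  vscale << c *g m1 >> (vmon v m2) = vmon (c *: v) (mmul m1 m2) :> vpoly V n.
Proof.
have le2 : msupp (vmon v m2 : vpoly V n) `<=` [fset m2].
  by rewrite vmon.unlock msuppU_le.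
rewrite (vscalew msuppU_le le2).
by rewrite !big_seq_fset1 mcoeffUU mcoeff_vmon eqxx.
Qed.

Lemma vscale0r P : vscale 0 P = 0.
Proof. by rewrite vscale.unlock msupp0 big_seq_fset0. Qed.

Lemma vscaler0 q : vscale q 0 = 0 :> vpoly V n.
Proof. by rewrite vscale.unlock big1 // => m _; rewrite msupp0 big_seq_fset0. Qed.

Lemma mpoly_indU (Q : {mpoly K[n]} -> Prop) :
  Q 0 -> (forall q q', Q q -> Q q' -> Q (q + q')) ->
  (forall c m, Q << c *g m >>) -> forall q, Q q.
Proof. by move=> Q0 QD QU q; rewrite [q]monalgE; elim/big_ind: _. Qed.

Lemma vscaleA q1 q2 P : vscale q1 (vscale q2 P) = vscale (q1 * q2) P.
Proof.
elim/vpoly_ind: P => [|P P' IH IH'|v m]; first by rewrite !vscaler0.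
  by rewrite !vscaleDr IH IH'.
elim/mpoly_indU: q1 => [|q q' IH IH'|c1 m1].
- by rewrite mul0r [LHS]vscale0r [RHS]vscale0r.
- by rewrite mulrDl [LHS]vscaleDl [RHS]vscaleDl IH IH'.
elim/mpoly_indU: q2 => [|q q' IH IH'|c2 m2].
- by rewrite mulr0 !vscale0r vscaler0.
- by rewrite mulrDr !vscaleDl vscaleDr IH IH'.
have -> : << c1 *g m1 >> * << c2 *g m2 >> = << c1 * c2 *g mmul m1 m2 >>
  :> {mpoly K[n]} by exact: fgmulUU.
apply: etrans (congr1 (vscale _) (vscaleUU c2 v m2 m)) _.
apply: etrans (vscaleUU c1 (c2 *: v) m1 (mmul m2 m)) _.
apply: etrans (esym (vscaleUU (c1 * c2) v (mmul m1 m2) m)).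
by rewrite scalerA mulmA.
Qed.

Lemma vscale1 P : vscale 1 P = P.
Proof.
elim/vpoly_ind: P => [|P P' IH IH'|v m].
- by rewrite vscaler0.
- by rewrite vscaleDr IH IH'.
by rewrite vscaleUU scale1r mul1m.
Qed.

End VPoly.

HB.instance Definition _ (K : fieldType) (V : lmodType K) n :=
  GRing.Zmodule_isLmodule.Build {mpoly K[n]} (vpoly V n)
    vscaleA vscale1 vscaleDr
    (fun P q1 q2 => vscaleDl q1 q2 P).

(* The variable λ_j of C[λ_0, ..., λ_(n-1)], with the junk value 0 when       *)
(* n <= j.                                                                    *)
Definition lam {K : fieldType} (n j : nat) : {mpoly K[n]} :=
  oapp (fun i : 'I_n => << ucm i >>) 0 (insub j).

(* Linear extension of f over polynomials combined with the substitution      *)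
(* λ_i := s i: the monomial λ^m v is sent to s^m f(v).                        *)
Definition mon_subst {K : fieldType} {l n} (s : 'I_l -> {mpoly K[n]})
    (m : 'X_{1..l}) : {mpoly K[n]} :=
  \prod_(i < l) s i ^+ m i.

HB.lock Definition vext (K : fieldType) (V W : lmodType K) (l n : nat)
    (s : 'I_l -> {mpoly K[n]}) (f : V -> vpoly W n) (P : vpoly V l) :
    vpoly W n :=
  \sum_(m <- msupp P) mon_subst s m *: f P@_m.
Arguments vext {K V W l n}.

Definition vsubst {K : fieldType} {V : lmodType K} {l n}
    (s : 'I_l -> {mpoly K[n]}) (P : vpoly V l) : vpoly V n :=
  vext s vconst P.

(* Graded C[∂]-modules. [gm_decomp] says that the sort is the internal direct *)
(* sum of the subspaces [gm_deg i].                                           *)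
Record gradedModule (K : fieldType) := GradedModule {
  gm_sort :> lmodType K;
  gm_der : {linear gm_sort -> gm_sort};
  gm_deg : int -> gm_sort -> Prop;
  gm_deg0 : forall i, gm_deg i 0;
  gm_degP : forall i (a : K) u v,
    gm_deg i u -> gm_deg i v -> gm_deg i (a *: u + v);
  gm_deg_der : forall i v, gm_deg i v -> gm_deg i (gm_der v);
  gm_decomp : forall v : gm_sort, exists! f : {malg gm_sort[int]},
    (forall i, gm_deg i f@_i) /\ v = \sum_(i <- msupp f) f@_i
}.

Arguments gm_der {K g}.
Arguments gm_deg {K g}.

Notation "∂" := gm_der.

HB.lock Definition vder (K : fieldType) (V : gradedModule K) (n : nat)
    (P : vpoly V n) : vpoly V n :=
  \sum_(m <- msupp P) vmon (∂ P@_m) m.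
Arguments vder {K V n}.

Section Cochains.
Context {K : fieldType} {V : gradedModule K}.

Definition vdeg {n} (e : int) (P : vpoly V n) : Prop :=
  forall m, gm_deg e P@_m.

(* Replace the i-th argument of v by x. *)
Definition upd {k} (v : {ffun 'I_k -> V}) (i : 'I_k) (x : V) :
    {ffun 'I_k -> V} :=
  [ffun j => if j == i then x else v j].

Definition multilinear {k n} (phi : {ffun 'I_k -> V} -> vpoly V n) : Prop :=
  forall (v : {ffun 'I_k -> V}) (i : 'I_k) (a : K) (x y : V),
    phi (upd v i (a *: x + y)) =
    a%:MP *: phi (upd v i x) + phi (upd v i y).

Definition sesquilinear {k} (phi : {ffun 'I_k.+1 -> V} -> vpoly V k) : Prop :=
  (forall (v : {ffun 'I_k.+1 -> V}) (i : 'I_k),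
     let i' := widen_ord (leqnSn k) i in
     phi (upd v i' (∂ (v i'))) = - lam k i *: phi v) /\
  (forall v : {ffun 'I_k.+1 -> V},
     phi (upd v ord_max (∂ (v ord_max))) =
     vder (phi v) + (\sum_(i < k) lam k i) *: phi v).

Definition of_degree {k} (n : int) (phi : {ffun 'I_k.+1 -> V} -> vpoly V k) :
    Prop :=
  forall (d : 'I_k.+1 -> int) (v : {ffun 'I_k.+1 -> V}),
    (forall j, gm_deg (d j) (v j)) -> vdeg (\sum_j d j + n) (phi v).

End Cochains.

(* Maps of arity k+1, with values in polynomials in k variables. *)
Definition cochain {K : fieldType} (V : gradedModule K) (k : nat) : Type :=
  {ffun 'I_k.+1 -> V} -> vpoly V k.

HB.instance Definition _ (K : fieldType) (V : gradedModule K) k :=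
  GRing.Zmodule.on (@cochain K V k).

Definition conformal_sesquilinear {K : fieldType} {V : gradedModule K} {k}
    (n : int) (phi : cochain V k) : Prop :=
  [/\ multilinear phi, sesquilinear phi & of_degree n phi].

Section Insertion.
Context {K : fieldType} {V : gradedModule K}.

(* (v_0, ..., v_(i-1), x, v_(i+l+1), ..., v_(k+l)) *)
Definition outer_args {p} k l (v : {ffun 'I_p.+1 -> V}) (i : nat) (x : V) :
    {ffun 'I_k.+1 -> V} :=
  [ffun j : 'I_k.+1 =>
     if (j < i)%N then v (inord j) else
     if (j == i :> nat)%N then x else v (inord (j + l)%N)].

(* (v_i, ..., v_(i+l)) *)
Definition inner_args {p} l (v : {ffun 'I_p.+1 -> V}) (i : nat) :
    {ffun 'I_l.+1 -> V} :=
  [ffun j : 'I_l.+1 => v (inord (i + j)%N)].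

(* (λ_0, ..., λ_(i-1), λ_i + ... + λ_(i+l), λ_(i+l+1), ...), k entries *)
Definition outer_vars p k l (i : nat) (j : 'I_k) : {mpoly K[p]} :=
  if (j < i)%N then lam p j else
  if (j == i :> nat)%N then
    \sum_(i <= r < (i + l.+1)%N) lam p r
  else lam p (j + l)%N.

(* (λ_i, ..., λ_(i+l-1)) *)
Definition inner_vars p l (i : nat) (j : 'I_l) : {mpoly K[p]} := lam p (i + j)%N.

(* f(v_0, ..., v_(i-1), g(v_i, ..., v_(i+l)), v_(i+l+1), ..., v_p) with these *)
(* subscripts; meant for p = k + l and i <= k.                                *)
Definition insertion {k l} (p : nat) (f : cochain V k) (g : cochain V l)
    (i : nat) (v : {ffun 'I_p.+1 -> V}) : vpoly V p :=
  vext (inner_vars p i)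
       (fun x => vsubst (outer_vars p l i) (f (outer_args k l v i x)))
       (g (inner_args l v i)).

Definition gm_components (v : V) : {malg V[int]} :=
  sval (cid (gm_decomp v)).

(* The linear map v |-> (-1)^(m |v|) v. *)
Definition koszul (m : int) (v : V) : V :=
  \sum_(i <- msupp (gm_components v)) (gm_components v)@_i *~ (-1) ^ (m * i).

Definition koszul_args {p} (m : int) (i : nat) (v : {ffun 'I_p.+1 -> V}) :
    {ffun 'I_p.+1 -> V} :=
  [ffun j : 'I_p.+1 => if (j < i)%N then koszul m (v j) else v j].

(* The component of arity p+1 of f ⋄ g, where m is the degree of g; on        *)
(* homogeneous arguments it is the usual signed sum, see [diamond_homog].     *)
Definition diamond {k l} (m : int) (p : nat) (f : cochain V k) (g : cochain V l)
    : cochain V p :=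
  fun v => \sum_(i < k.+1) insertion f g i (koszul_args m i v).

End Insertion.

(* Products in {mpoly K[n]} are rearranged through abstract lemmas, because    *)
(* conversion of concrete products is costly.                                 *)
Lemma scale_rotate (R : comPzRingType) (W : lmodType R) (a b c : R) (w : W) :
  (a * b) *: (c *: w) = (c * a) *: (b *: w).
Proof. by rewrite !scalerA [a * b * c]mulrC mulrA. Qed.

Lemma scalerAC (R : comPzRingType) (W : lmodType R) (a b : R) (w : W) :
  a *: (b *: w) = b *: (a *: w).
Proof. by rewrite !scalerA mulrC. Qed.

Section VextTheory.
Context {K : fieldType} {V W : lmodType K} {l n : nat}.
Implicit Types (s : 'I_l -> {mpoly K[n]}) (f g : V -> vpoly W n).
Implicit Types (P : vpoly V l).

Definition klinear f : Prop :=
  forall (a : K) (x y : V), f (a *: x + y) = a%:MP *: f x + f y.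

Lemma mon_subst1 s : mon_subst s mone = 1.
Proof. by rewrite /mon_subst big1 // => i _; rewrite cm1 expr0. Qed.

Lemma mon_substM s m1 m2 :
  mon_subst s (mmul m1 m2) = mon_subst s m1 * mon_subst s m2.
Proof.
by rewrite /mon_subst -big_split; apply: eq_bigr => i _; rewrite cmM exprD.
Qed.

Lemma mon_substU s i : mon_subst s (ucm i) = s i.
Proof.
rewrite /mon_subst (bigD1 i) //= cmUU expr1 big1 ?mulr1 // => j ji.
by rewrite cmU eq_sym (negbTE ji) expr0.
Qed.

Section Linear.
Variables (f : V -> vpoly W n) (fK : klinear f).

Lemma klinear0 : f 0 = 0.
Proof.
have := fK 1 0 0; rewrite scale1r addr0 rmorph1 scale1r => /eqP.
by rewrite -{1}[f 0]addr0 (inj_eq (addrI _)) eq_sym => /eqP.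
Qed.

Lemma klinearD x y : f (x + y) = f x + f y.
Proof. by have := fK 1 x y; rewrite scale1r rmorph1 scale1r. Qed.

Lemma klinearZ a x : f (a *: x) = a%:MP *: f x.
Proof. by have := fK a x 0; rewrite addr0 klinear0 addr0. Qed.

Lemma vextw s (d : {fset 'X_{1..l}}) P : msupp P `<=` d ->
  vext s f P = \sum_(m <- d) mon_subst s m *: f P@_m.
Proof.
move=> le; rewrite vext.unlock (big_fset_incl _ le) // => m _ /mcoeff_outdom ->.
by rewrite klinear0 scaler0.
Qed.

Lemma vextD s : {morph vext s f : P P' / P + P'}.
Proof.
move=> P P'.
have s1 := fsubsetUl (msupp P) (msupp P').
have s2 := fsubsetUr (msupp P) (msupp P').
have s3 := msuppD_le P P'.
rewrite (vextw s s1) (vextw s s2) (vextw s s3) -big_split.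
by apply: eq_bigr => m _; rewrite mcoeffD klinearD scalerDr.
Qed.

Lemma vext0 s : vext s f 0 = 0.
Proof. by rewrite vext.unlock msupp0 big_seq_fset0. Qed.

Lemma vextU s v m : vext s f (vmon v m) = mon_subst s m *: f v.
Proof.
have le : msupp (vmon v m : vpoly V l) `<=` [fset m].
  by rewrite vmon.unlock msuppU_le.
by rewrite (vextw s le) big_seq_fset1 mcoeff_vmon eqxx.
Qed.

Lemma vextM s c m P :
  vext s f (<< c *g m >> *: P) = (c%:MP * mon_subst s m) *: vext s f P.
Proof.
elim/(@vpoly_ind K V): P => [|P P' IH IH'|v m'].
- by rewrite scaler0 vext0 scaler0.
- by rewrite scalerDr !vextD scalerDr IH IH'.
have -> : << c *g m >> *: (vmon v m' : vpoly V l) = vmon (c *: v) (mmul m m').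
  exact: vscaleUU.
rewrite (vextU s (c *: v)) (vextU s v) klinearZ mon_substM.
exact: scale_rotate.
Qed.

Lemma vextC s c P : vext s f (c%:MP *: P) = c%:MP *: vext s f P.
Proof. by rewrite vextM mon_subst1 mulr1. Qed.

Lemma vextX s i P : vext s f (<< ucm i >> *: P) = s i *: vext s f P.
Proof. by rewrite vextM mon_substU rmorph1 mul1r. Qed.

Lemma vextN s P : vext s f (- P) = - vext s f P.
Proof. by apply/eqP; rewrite -addr_eq0 -vextD addNr vext0. Qed.

End Linear.

Lemma eq_vext s f g P : f =1 g -> vext s f P = vext s g P.
Proof.
by move=> fg; rewrite vext.unlock; apply: eq_bigr => m _; rewrite fg.
Qed.

Lemma vext_lin s q f g P :
  vext s (fun x => q *: f x + g x) P = q *: vext s f P + vext s g P.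
Proof.
rewrite vext.unlock scaler_sumr -big_split; apply: eq_bigr => m _ /=.
by rewrite scalerDr; congr (_ + _); exact: scalerAC.
Qed.

Lemma vext_scale s q f P : vext s (fun x => q *: f x) P = q *: vext s f P.
Proof.
rewrite vext.unlock scaler_sumr; apply: eq_bigr => m _ /=.
exact: scalerAC.
Qed.

End VextTheory.

Lemma vconst_klinear {K : fieldType} {V : lmodType K} {n} :
  klinear (@vconst K V n).
Proof.
move=> a x y; rewrite /vconst vmonD; congr (_ + _); symmetry.
by apply: etrans (vscaleUU _ _ _ _) _; rewrite mulm1.
Qed.

Section VderTheory.
Context {K : fieldType} {V : gradedModule K}.

Lemma vder0 n : vder (0 : vpoly V n) = 0.
Proof. by rewrite vder.unlock msupp0 big_seq_fset0. Qed.

Lemma vderw n (P : vpoly V n) (d : {fset 'X_{1..n}}) : msupp P `<=` d ->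
  vder P = \sum_(m <- d) vmon (∂ P@_m) m.
Proof.
move=> le; rewrite vder.unlock (big_fset_incl _ le) // => m _ /mcoeff_outdom ->.
by rewrite linear0 vmon0.
Qed.

Lemma vderD n : {morph @vder K V n : P P' / P + P'}.
Proof.
move=> P P'.
have s1 := fsubsetUl (msupp P) (msupp P').
have s2 := fsubsetUr (msupp P) (msupp P').
have s3 := msuppD_le P P'.
rewrite (vderw s1) (vderw s2) (vderw s3) -big_split.
by apply: eq_bigr => m _; rewrite mcoeffD linearD vmonD.
Qed.

Lemma vderU n v m : vder (vmon v m : vpoly V n) = vmon (∂ v) m.
Proof.
have le : msupp (vmon v m : vpoly V n) `<=` [fset m].
  by rewrite vmon.unlock msuppU_le.
by rewrite (vderw le) big_seq_fset1 mcoeff_vmon eqxx.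
Qed.

Lemma mcoeff_vder n (P : vpoly V n) m : (vder P)@_m = ∂ P@_m.
Proof.
elim/(@vpoly_ind K V): P => [|P P' IH IH'|v m'].
- by rewrite vder0 !mcoeff0 linear0.
- by rewrite vderD !mcoeffD linearD IH IH'.
by rewrite vderU !mcoeff_vmon; case: eqP => _; rewrite ?mulr1n ?mulr0n ?linear0.
Qed.

Lemma vderZ n q (P : vpoly V n) : vder (q *: P) = q *: vder P.
Proof.
elim/(@vpoly_ind K V): P => [|P P' IH IH'|v m'].
- by rewrite scaler0 vder0 scaler0.
- by rewrite scalerDr !vderD scalerDr IH IH'.
elim/(@mpoly_indU K n): q => [|q q' IH IH'|c m].
- by rewrite !scale0r vder0.
- by rewrite !scalerDl vderD IH IH'.
rewrite vderU.
have E w : << c *g m >> *: (vmon w m' : vpoly V n) = vmon (c *: w) (mmul m m').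
  exact: vscaleUU.
by rewrite !E vderU linearZ.
Qed.

Lemma vder_sum n (I : Type) (r : seq I) (F : I -> vpoly V n) :
  vder (\sum_(i <- r) F i) = \sum_(i <- r) vder (F i).
Proof. exact: (big_morph _ (@vderD n) (@vder0 n)). Qed.

Lemma vder_vext (W : lmodType K) l n (s : 'I_l -> {mpoly K[n]})
    (f : W -> vpoly V n) (P : vpoly W l) :
  vder (vext s f P) = vext s (fun x => vder (f x)) P.
Proof.
by rewrite vext.unlock vder_sum; apply: eq_bigr => m _; rewrite vderZ.
Qed.

Lemma vext_vder l n (s : 'I_l -> {mpoly K[n]}) (f : V -> vpoly V n)
    (P : vpoly V l) : klinear f ->
  vext s f (vder P) = vext s (fun x => f (∂ x)) P.
Proof.
move=> fK.
have fK' : klinear (fun x => f (∂ x)) by move=> a x y; rewrite linearP fK.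
elim/(@vpoly_ind K V): P => [|P P' IH IH'|v m'].
- by rewrite vder0 !vext0.
- by rewrite vderD !vextD // IH IH'.
by rewrite vderU !vextU.
Qed.

Lemma vder_vsubst l n (s : 'I_l -> {mpoly K[n]}) (P : vpoly V l) :
  vder (vsubst s P) = vsubst s (vder P).
Proof.
rewrite /vsubst vder_vext vext_vder; last exact: vconst_klinear.
by apply: eq_vext => x; rewrite /vconst vderU.
Qed.

(* Closure of [vdeg]. *)
Lemma gm_degD e (u v : V) : gm_deg e u -> gm_deg e v -> gm_deg e (u + v).
Proof. by move=> du dv; have := gm_degP 1 du dv; rewrite scale1r. Qed.

Lemma gm_degZ e a (u : V) : gm_deg e u -> gm_deg e (a *: u).
Proof. by move=> du; have := gm_degP a du (gm_deg0 V e); rewrite addr0. Qed.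

Lemma gm_degMz e (u : V) (z : int) : gm_deg e u -> gm_deg e (u *~ z).
Proof. by move=> du; rewrite -scaler_int; apply: gm_degZ. Qed.

Lemma vdeg0 n e : vdeg e (0 : vpoly V n).
Proof. by move=> m; rewrite mcoeff0; apply: gm_deg0. Qed.

Lemma vdegD n e (P P' : vpoly V n) : vdeg e P -> vdeg e P' -> vdeg e (P + P').
Proof. by move=> dP dP' m; rewrite mcoeffD; apply: gm_degD. Qed.

Lemma vdegMz n e (P : vpoly V n) z : vdeg e P -> vdeg e (P *~ z).
Proof.
move=> dP m; have -> : (P *~ z)@_m = P@_m *~ z by exact: raddfMz.
exact: gm_degMz.
Qed.

Lemma vdeg_sum n e (I : Type) (r : seq I) (F : I -> vpoly V n) :
  (forall i, vdeg e (F i)) -> vdeg e (\sum_(i <- r) F i).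
Proof.
by move=> dF; elim/big_ind: _ => //; [exact: vdeg0 | exact: vdegD].
Qed.

Lemma vdeg_vmon n e v m : gm_deg e v -> vdeg e (vmon v m : vpoly V n).
Proof.
move=> dv m'; rewrite mcoeff_vmon; case: eqP => _; rewrite ?mulr1n //.
exact: gm_deg0.
Qed.

Lemma vdegZ n e q (P : vpoly V n) : vdeg e P -> vdeg e (q *: P).
Proof.
move=> dP; change (vdeg e (vscale q P)); rewrite vscale.unlock.
apply: vdeg_sum => m; apply: vdeg_sum => m'.
by apply: vdeg_vmon; apply: gm_degZ.
Qed.

Lemma vdeg_vext l n e e' (s : 'I_l -> {mpoly K[n]}) (f : V -> vpoly V n)
    (P : vpoly V l) :
  (forall x, gm_deg e x -> vdeg e' (f x)) -> vdeg e P -> vdeg e' (vext s f P).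
Proof.
move=> df dP; rewrite vext.unlock; apply: vdeg_sum => m.
by apply: vdegZ; apply: df.
Qed.

Lemma vdeg_vsubst l n e (s : 'I_l -> {mpoly K[n]}) (P : vpoly V l) :
  vdeg e P -> vdeg e (vsubst s P).
Proof. by apply: vdeg_vext => x dx; apply: vdeg_vmon. Qed.

End VderTheory.

Section KoszulTheory.
Context {K : fieldType} {V : gradedModule K}.
Implicit Types (u v w : V) (m : int).

Lemma gm_componentsP v : (forall i, gm_deg i (gm_components v)@_i) /\
  v = \sum_(i <- msupp (gm_components v)) (gm_components v)@_i.
Proof. by rewrite /gm_components; case: cid => f []. Qed.

Lemma gm_components_uniq v (f : {malg V[int]}) : (forall i, gm_deg i f@_i) ->
  v = \sum_(i <- msupp f) f@_i -> gm_components v = f.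
Proof.
move=> fd fE; rewrite /gm_components; case: cid => g /= [_ guniq].
exact: guniq.
Qed.

Lemma malg_sumw (h : int -> V -> V) (f : {malg V[int]}) (d : {fset int}) :
  (forall i, h i 0 = 0) -> msupp f `<=` d ->
  \sum_(i <- msupp f) h i f@_i = \sum_(i <- d) h i f@_i.
Proof.
by move=> h0 le; apply: big_fset_incl => // i _ /mcoeff_outdom ->.
Qed.

Lemma gm_components_eq v (d : {fset int}) (F : int -> V) :
  (forall i, gm_deg i (F i)) -> (forall i, i \notin d -> F i = 0) ->
  v = \sum_(i <- d) F i ->
  forall i, (gm_components v)@_i = F i.
Proof.
move=> Fd F0 vE.
have cE i : [malg i in d => F i]@_i = F i.
  by rewrite mcoeffE; case: ifPn => // /F0.
move=> i; rewrite (@gm_components_uniq v [malg i in d => F i]) //.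
- by move=> e; rewrite cE.
have le : msupp [malg i in d => F i] `<=` d.
  apply/fsubsetP => e; rewrite -mcoeff_neq0 cE.
  by apply: contraNT => /F0 ->.
rewrite (@malg_sumw (fun _ x => x) _ d) // vE.
by apply: eq_bigr => e _; rewrite cE.
Qed.

Lemma gm_components_outdom v i :
  i \notin msupp (gm_components v) -> (gm_components v)@_i = 0.
Proof. exact: mcoeff_outdom. Qed.

Lemma gm_componentsL a u v i : (gm_components (a *: u + v))@_i =
  a *: (gm_components u)@_i + (gm_components v)@_i.
Proof.
pose d := msupp (gm_components u) `|` msupp (gm_components v).
move: i; apply: (@gm_components_eq _ d).
- move=> i; apply: gm_degP; by [apply: (gm_componentsP u).1
                              |apply: (gm_componentsP v).1].
- move=> i; rewrite in_fsetU negb_or => /andP[iu iv].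
  by rewrite !gm_components_outdom // scaler0 addr0.
rewrite big_split /= -scaler_sumr; congr (_ *: _ + _).
  rewrite {1}(gm_componentsP u).2.
  exact: (@malg_sumw (fun _ x => x) _ d _ (fsubsetUl _ _)).
rewrite {1}(gm_componentsP v).2.
exact: (@malg_sumw (fun _ x => x) _ d _ (fsubsetUr _ _)).
Qed.

Lemma gm_components_der v i :
  (gm_components (∂ v))@_i = ∂ (gm_components v)@_i.
Proof.
move: i; apply: (@gm_components_eq _ (msupp (gm_components v))).
- by move=> i; apply: gm_deg_der; apply: (gm_componentsP v).1.
- by move=> i /gm_components_outdom ->; rewrite linear0.
by rewrite {1}(gm_componentsP v).2 linear_sum.
Qed.

Lemma gm_components_homog d v i : gm_deg d v ->
  (gm_components v)@_i = if i == d then v else 0.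
Proof.
move=> dv; move: i; apply: (@gm_components_eq _ [fset d]).
- by move=> i; case: eqP => [->//|_]; apply: gm_deg0.
- by move=> i; rewrite in_fset1 => /negbTE ->.
by rewrite big_seq_fset1 eqxx.
Qed.

Lemma koszulw m v (d : {fset int}) : msupp (gm_components v) `<=` d ->
  koszul m v = \sum_(i <- d) (gm_components v)@_i *~ (-1) ^ (m * i).
Proof.
by apply: (@malg_sumw (fun i x => x *~ (-1) ^ (m * i))) => i; rewrite mul0rz.
Qed.

Lemma koszulL m a u v : koszul m (a *: u + v) = a *: koszul m u + koszul m v.
Proof.
pose d := msupp (gm_components u) `|` msupp (gm_components v)
          `|` msupp (gm_components (a *: u + v)).
have le1 : msupp (gm_components u) `<=` d.
  by rewrite /d -fsetUA fsubsetUl.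
have le2 : msupp (gm_components v) `<=` d.
  by rewrite /d fsetUAC fsubsetUr.
have le3 : msupp (gm_components (a *: u + v)) `<=` d by rewrite fsubsetUr.
rewrite (koszulw m le1) (koszulw m le2) (koszulw m le3).
rewrite scaler_sumr -big_split; apply: eq_bigr => i _ /=.
by rewrite gm_componentsL mulrzDl scalerMzr.
Qed.

Lemma koszul_der m v : koszul m (∂ v) = ∂ (koszul m v).
Proof.
pose d := msupp (gm_components v) `|` msupp (gm_components (∂ v)).
rewrite (@koszulw m v d) ?fsubsetUl // (@koszulw m (∂ v) d) ?fsubsetUr //.
rewrite linear_sum; apply: eq_bigr => i _.
by rewrite gm_components_der raddfMz.
Qed.

Lemma koszul_homog m d v : gm_deg d v -> koszul m v = v *~ (-1) ^ (m * d).
Proof.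
move=> dv; rewrite (@koszulw m v (msupp (gm_components v) `|` [fset d])).
  rewrite (big_fsetD1 d) /=; last by rewrite in_fsetU in_fset1 eqxx orbT.
  rewrite big1_fset ?addr0; first by rewrite (gm_components_homog _ dv) eqxx.
  move=> i; rewrite in_fsetD1 => /andP[/negbTE id _] _.
  by rewrite (gm_components_homog _ dv) id mul0rz.
exact: fsubsetUl.
Qed.

Lemma koszul_deg m d v : gm_deg d v -> gm_deg d (koszul m v).
Proof. by move=> dv; rewrite (koszul_homog m dv); apply: gm_degMz. Qed.

End KoszulTheory.

Section InsertionTheory.
Context {K : fieldType} {V : gradedModule K}.

Lemma inord_eq p a (j : 'I_p.+1) : (a < p.+1)%N ->
  (inord a == j) = (a == j :> nat).
Proof. by move=> ap; rewrite -val_eqE /= inordK. Qed.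

Lemma lamE n (i : 'I_n) : lam n i = << ucm i >> :> {mpoly K[n]}.
Proof. by rewrite /lam valK. Qed.

Lemma sum_block (M : zmodType) (F : nat -> M) (x : M) (k l i : nat) :
  (i < k)%N ->
  \sum_(0 <= a < k) (if (a < i)%N then F a else
                     if (a == i)%N then x else F (a + l)%N) =
  \sum_(0 <= r < i) F r + x + \sum_(i + l.+1 <= r < k + l) F r.
Proof.
move=> ik; rewrite (big_cat_nat _ (n := i)) //=; last exact: ltnW.
rewrite [X in _ + X]big_ltn // ltnn eqxx addrA; congr (_ + _ + _).
  by apply: eq_big_nat => a /andP[_ ->].
have -> : (i + l.+1 = i.+1 + l)%N by lia.
rewrite big_addn addnK; apply: eq_big_nat => a /andP[ia _].
by rewrite ifF ?ifF //; lia.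
Qed.

Lemma sum_split (M : zmodType) (F : nat -> M) (k l i : nat) : (i < k)%N ->
  \sum_(0 <= r < k + l) F r =
  \sum_(0 <= r < i) F r + \sum_(i <= r < i + l.+1) F r +
  \sum_(i + l.+1 <= r < k + l) F r.
Proof.
by move=> ik; rewrite -big_cat_nat ?leq_addr // -big_cat_nat //; lia.
Qed.

Lemma sum_shift (M : zmodType) (F : nat -> M) (i l : nat) :
  \sum_(i <= r < i + l) F r = \sum_(r < l) F (i + r)%N.
Proof.
rewrite -[X in \sum_(X <= _ < _) _]add0n big_addn addKn big_mkord.
by apply: eq_bigr => r _; rewrite addnC.
Qed.

Section Args.
Variables (p k l : nat).
Hypothesis pE : p = (k + l)%N.
Variables (v : {ffun 'I_p.+1 -> V}) (i : nat).
Hypothesis ik : (i <= k)%N.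

Lemma outer_args_upd_lt (j : 'I_p.+1) x y : (j < i)%N ->
  outer_args k l (upd v j y) i x = upd (outer_args k l v i x) (inord j) y.
Proof.
move=> ji; apply/ffunP => a; rewrite !ffunE; have ak := ltn_ord a.
rewrite !inord_eq; try lia.
rewrite -[in RHS]val_eqE /= inordK; last by lia.
do ![case: ifP => ? //]; lia.
Qed.

Lemma outer_args_upd_in (j : 'I_p.+1) x y : (i <= j <= i + l)%N ->
  outer_args k l (upd v j y) i x = outer_args k l v i x.
Proof.
move=> ji; apply/ffunP => a; rewrite !ffunE; have ak := ltn_ord a.
rewrite !inord_eq; try lia.
do ![case: ifP => ? //]; lia.
Qed.

Lemma outer_args_upd_gt (j : 'I_p.+1) x y : (i + l < j)%N ->
  outer_args k l (upd v j y) i x = upd (outer_args k l v i x) (inord (j - l)) y.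
Proof.
move=> ji; apply/ffunP => a; rewrite !ffunE; have ak := ltn_ord a.
have jp := ltn_ord j.
rewrite !inord_eq; try lia.
rewrite -[in RHS]val_eqE /= inordK; last by lia.
do ![case: ifP => ? //]; lia.
Qed.

Lemma inner_args_upd_in (j : 'I_p.+1) y : (i <= j <= i + l)%N ->
  inner_args l (upd v j y) i = upd (inner_args l v i) (inord (j - i)) y.
Proof.
move=> ji; apply/ffunP => a; rewrite !ffunE; have ak := ltn_ord a.
rewrite !inord_eq; try lia.
rewrite -[in RHS]val_eqE /= inordK; last by lia.
do ![case: ifP => ? //]; lia.
Qed.

Lemma inner_args_upd_out (j : 'I_p.+1) y : ~~ (i <= j <= i + l)%N ->
  inner_args l (upd v j y) i = inner_args l v i.
Proof.
move=> ji; apply/ffunP => a; rewrite !ffunE; have ak := ltn_ord a.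
rewrite !inord_eq; try lia.
do ![case: ifP => ? //]; lia.
Qed.

Lemma outer_argsE x :
  outer_args k l v i x = upd (outer_args k l v i 0) (inord i) x.
Proof.
apply/ffunP => a; rewrite !ffunE.
rewrite -[in RHS]val_eqE /= inordK; last by lia.
do ![case: ifP => ? //]; lia.
Qed.

Lemma outer_args_lt x (j : 'I_p.+1) : (j < i)%N ->
  outer_args k l v i x (inord j) = v j.
Proof.
move=> ji; rewrite !ffunE inordK; last by lia.
by rewrite ji inord_val.
Qed.

Lemma outer_args_gt x (j : 'I_p.+1) : (i + l < j)%N ->
  outer_args k l v i x (inord (j - l)) = v j.
Proof.
move=> ji; have jp := ltn_ord j; rewrite !ffunE inordK; last by lia.
by rewrite !ifF ?subnK ?inord_val //; lia.
Qed.

Lemma inner_argsE (j : 'I_p.+1) : (i <= j <= i + l)%N ->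
  inner_args l v i (inord (j - i)) = v j.
Proof.
move=> ji; rewrite !ffunE inordK; last by lia.
by rewrite subnKC ?inord_val //; lia.
Qed.

End Args.

Lemma upd_mid k (w : {ffun 'I_k -> V}) (a : 'I_k) x y :
  upd (upd w a x) a y = upd w a y.
Proof. by apply/ffunP => b; rewrite !ffunE; case: eqP. Qed.

Lemma updE k (w : {ffun 'I_k -> V}) (a : 'I_k) x : upd w a x a = x.
Proof. by rewrite ffunE eqxx. Qed.

Section Insert.
Variables (p k l : nat) (n m : int) (f : cochain V k) (g : cochain V l).
Hypothesis pE : p = (k + l)%N.
Hypotheses (fcs : conformal_sesquilinear n f) (gcs : conformal_sesquilinear m g).

Let fmul : multilinear f. Proof. by case: fcs. Qed.
Let gmul : multilinear g. Proof. by case: gcs. Qed.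

Let fmid (w : {ffun 'I_k.+1 -> V}) (a : 'I_k.+1) : (a < k)%N ->
  f (upd w a (∂ (w a))) = - lam k a *: f w.
Proof.
case: fcs => _ [fs _] _ ak; have := fs w (Ordinal ak) => /=.
by have -> : widen_ord (leqnSn k) (Ordinal ak) = a by apply: val_inj.
Qed.

Let gmid (w : {ffun 'I_l.+1 -> V}) (a : 'I_l.+1) : (a < l)%N ->
  g (upd w a (∂ (w a))) = - lam l a *: g w.
Proof.
case: gcs => _ [gs _] _ al; have := gs w (Ordinal al) => /=.
by have -> : widen_ord (leqnSn l) (Ordinal al) = a by apply: val_inj.
Qed.

Let flast (w : {ffun 'I_k.+1 -> V}) (a : 'I_k.+1) : a = k :> nat ->
  f (upd w a (∂ (w a))) = vder (f w) + (\sum_(r < k) lam k r) *: f w.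
Proof.
case: fcs => _ [_ fs] _ ak; rewrite -fs.
by have -> : a = ord_max by apply: val_inj.
Qed.

Let glast (w : {ffun 'I_l.+1 -> V}) (a : 'I_l.+1) : a = l :> nat ->
  g (upd w a (∂ (w a))) = vder (g w) + (\sum_(r < l) lam l r) *: g w.
Proof.
case: gcs => _ [_ gs] _ al; rewrite -gs.
by have -> : a = ord_max by apply: val_inj.
Qed.

Let sum_pE (M : zmodType) (F : nat -> M) :
  \sum_(0 <= r < p) F r = \sum_(0 <= r < k + l) F r.
Proof. by rewrite pE. Qed.

Lemma vsubst_lam q (s : 'I_q -> {mpoly K[p]}) (P : vpoly V q) (r : 'I_q) :
  vsubst s (lam q r *: P) = s r *: vsubst s P.
Proof. by rewrite lamE /vsubst; apply: vextX; apply: vconst_klinear. Qed.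

Lemma vext_lam q (s : 'I_q -> {mpoly K[p]}) (h : V -> vpoly V p)
    (P : vpoly V q) (r : 'I_q) : klinear h ->
  vext s h (lam q r *: P) = s r *: vext s h P.
Proof. by move=> hK; rewrite lamE; apply: vextX. Qed.

Lemma vext_sum_lam q (s : 'I_q -> {mpoly K[p]}) (h : V -> vpoly V p)
    (P : vpoly V q) : klinear h ->
  vext s h ((\sum_(r < q) lam q r) *: P) = (\sum_(r < q) s r) *: vext s h P.
Proof.
move=> hK; rewrite !scaler_suml.
rewrite (big_morph _ (vextD hK s) (vext0 h s)).
by apply: eq_bigr => r _; apply: vext_lam.
Qed.

Section AtI.
Variables (i : nat).
Hypothesis ik : (i <= k)%N.

Let s := outer_vars (K := K) p (k := k) l i.
Let t := inner_vars (K := K) p (l := l) i.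
Let h (v : {ffun 'I_p.+1 -> V}) (x : V) := vsubst s (f (outer_args k l v i x)).

Let hK v : klinear (h v).
Proof.
move=> a x y; rewrite /h /vsubst outer_argsE // fmul -!outer_argsE //.
have cK := @vconst_klinear K V p.
by rewrite (vextD cK) (vextC cK).
Qed.

Lemma insertionE v : insertion f g i v = vext t (h v) (g (inner_args l v i)).
Proof. by []. Qed.

Lemma insertion_multilinear : multilinear (fun v => insertion f g i v : vpoly V p).
Proof.
move=> v j a x y; rewrite !insertionE.
have cK := @vconst_klinear K V p.
have [ji|ij] := ltnP j i.
  have jo z : inner_args l (upd v j z) i = inner_args l v i.
    by apply: (inner_args_upd_out pE _ ik); lia.
  rewrite !jo -vext_lin; apply: eq_vext => z.
  rewrite /h !(outer_args_upd_lt pE) // fmul.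
  by rewrite /vsubst (vextD cK) (vextC cK).
have [ji|{}ij'] := leqP j (i + l)%N.
  have jh z : h (upd v j z) = h v.
    by apply/funext => w; rewrite /h (outer_args_upd_in pE) // ij.
  rewrite !jh !(inner_args_upd_in pE _ ik) ?ij // gmul.
  by rewrite (vextD (hK v)) (vextC (hK v)).
have jo z : inner_args l (upd v j z) i = inner_args l v i.
  by apply: (inner_args_upd_out pE _ ik); lia.
rewrite !jo -vext_lin; apply: eq_vext => z.
rewrite /h !(outer_args_upd_gt pE) // fmul.
by rewrite /vsubst (vextD cK) (vextC cK).
Qed.

Let h_der_lt v x : (i < k)%N ->
  h v (∂ x) = - (\sum_(i <= r < i + l.+1) lam p r) *: h v x.
Proof.
move=> ilt; rewrite /h outer_argsE // [in RHS]outer_argsE //.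
set w := upd _ _ x.
have iE : (inord i : 'I_k.+1) = i :> nat by rewrite inordK.
have -> : upd (outer_args k l v i 0) (inord i) (∂ x) =
          upd w (inord i) (∂ (w (inord i))) by rewrite updE upd_mid.
rewrite fmid ?iE // scaleNr.
have cK := @vconst_klinear K V p.
rewrite {1}/vsubst (vextN cK) -[vext _ _ _]/(vsubst _ _).
have -> : lam k i = lam k (Ordinal ilt) :> {mpoly K[k]} by [].
by rewrite vsubst_lam /s /outer_vars /= ltnn eqxx scaleNr.
Qed.

Let h_der_last v x : i = k ->
  h v (∂ x) = vder (h v x) + (\sum_(0 <= r < k) lam p r) *: h v x.
Proof.
move=> iE; rewrite /h outer_argsE // [in RHS]outer_argsE //.
set w := upd _ _ x.
have -> : upd (outer_args k l v i 0) (inord i) (∂ x) =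
          upd w (inord i) (∂ (w (inord i))) by rewrite updE upd_mid.
rewrite flast ?inordK //.
have cK := @vconst_klinear K V p.
rewrite {1}/vsubst (vextD cK) (vext_sum_lam _ _ cK) -!/(vsubst _ _).
rewrite vder_vsubst big_mkord; congr (_ + _ *: _).
by apply: eq_bigr => r _; rewrite /s /outer_vars iE ltn_ord.
Qed.

Lemma insertion_mid v (j : 'I_p.+1) : (j < p)%N ->
  insertion f g i (upd v j (∂ (v j))) = - lam p j *: insertion f g i v.
Proof.
move=> jp; rewrite !insertionE.
have cK := @vconst_klinear K V p.
have [ji|ij] := ltnP j i.
  rewrite (inner_args_upd_out pE _ ik); last by lia.
  rewrite -vext_scale; apply: eq_vext => z.
  rewrite /h (outer_args_upd_lt pE) //.
  have jE : (inord j : 'I_k.+1) = j :> nat by rewrite inordK //; lia.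
  rewrite -[v j in LHS](outer_args_lt pE v ik z) // fmid ?jE; last by lia.
  have jk : (j < k)%N by lia.
  rewrite !scaleNr {1}/vsubst (vextN cK) -[vext _ _ _]/(vsubst _ _).
  have -> : lam k j = lam k (Ordinal jk) :> {mpoly K[k]} by [].
  by rewrite vsubst_lam /s /outer_vars /= ji.
have [ji|ji] := leqP j (i + l)%N; last first.
  rewrite (inner_args_upd_out pE _ ik); last by lia.
  rewrite -vext_scale; apply: eq_vext => z.
  rewrite /h (outer_args_upd_gt pE) //.
  have jE : (inord (j - l) : 'I_k.+1) = (j - l)%N :> nat by rewrite inordK //; lia.
  rewrite -[v j in LHS](outer_args_gt pE v ik z) // fmid ?jE; last by lia.
  have jk : (j - l < k)%N by lia.
  rewrite !scaleNr {1}/vsubst (vextN cK) -[vext _ _ _]/(vsubst _ _).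
  have -> : lam k (j - l) = lam k (Ordinal jk) :> {mpoly K[k]} by [].
  rewrite vsubst_lam /s /outer_vars /= !ifF ?subnK //; lia.
have -> : h (upd v j (∂ (v j))) = h v.
  by apply/funext => w; rewrite /h (outer_args_upd_in pE) // ij.
have jE : (inord (j - i) : 'I_l.+1) = (j - i)%N :> nat by rewrite inordK //; lia.
rewrite (inner_args_upd_in pE _ ik) ?ij //.
rewrite -[v j in LHS](inner_argsE pE v ik) ?ij //.
have [jl|jl] := ltnP j (i + l)%N.
  rewrite gmid ?jE; last by lia.
  have jk : (j - i < l)%N by lia.
  rewrite !scaleNr (vextN (hK v)).
  have -> : lam l (j - i) = lam l (Ordinal jk) :> {mpoly K[l]} by [].
  by rewrite vext_lam // /t /inner_vars /= subnKC.
have {jl ji}jil : j = (i + l)%N :> nat by lia.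
rewrite glast ?jE; last by lia.
rewrite (vextD (hK v)) vext_vder // vext_sum_lam //.
have ilt : (i < k)%N by lia.
rewrite (eq_vext _ _ (fun x => h_der_lt v x ilt)) vext_scale -scalerDl.
congr (_ *: _); rewrite addnS big_nat_recr ?leq_addr //= -jil.
have -> : \sum_(r < l) t r = \sum_(i <= r < j) lam p r.
  by rewrite jil sum_shift.
by rewrite opprD addrAC addNr add0r.
Qed.

Lemma insertion_last v (j : 'I_p.+1) : j = p :> nat ->
  insertion f g i (upd v j (∂ (v j))) =
  vder (insertion f g i v) + (\sum_(r < p) lam p r) *: insertion f g i v.
Proof.
move=> jp; rewrite !insertionE.
have cK := @vconst_klinear K V p.
rewrite -(big_mkord xpredT (lam p)) vder_vext.
have [ilt|{}ki] := ltnP i k.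
  rewrite (inner_args_upd_out pE _ ik); last by lia.
  rewrite addrC -vext_lin; apply: eq_vext => z.
  rewrite /h (outer_args_upd_gt pE) //; last by lia.
  have jE : (inord (j - l) : 'I_k.+1) = (j - l)%N :> nat by rewrite inordK //; lia.
  rewrite -[v j in LHS](outer_args_gt pE v ik z) //; try by lia.
  rewrite flast ?jE; last by lia.
  rewrite {1}/vsubst (vextD cK) (vext_sum_lam _ _ cK) -!/(vsubst _ _).
  rewrite addrC vder_vsubst; congr (_ *: _ + _).
  rewrite sum_pE (sum_split _ _ ilt) -(sum_block _ _ _ ilt) big_mkord.
  by apply: eq_bigr => r _.
have iE : i = k by lia.
have -> : h (upd v j (∂ (v j))) = h v.
  by apply/funext => w; rewrite /h (outer_args_upd_in pE) //; lia.
have jE : (inord (j - i) : 'I_l.+1) = (j - i)%N :> nat by rewrite inordK //; lia.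
rewrite (inner_args_upd_in pE _ ik); last by lia.
rewrite -[v j in LHS](inner_argsE pE v ik) //; last by lia.
rewrite glast ?jE; last by lia.
rewrite (vextD (hK v)) vext_vder // vext_sum_lam //.
rewrite (eq_vext _ _ (fun x => h_der_last v x iE)).
under eq_vext => x do rewrite addrC.
rewrite vext_lin addrAC addrC -scalerDl; congr (_ + _ *: _).
rewrite sum_pE [in RHS](big_cat_nat _ (n := k)) ?leq_addr //=; congr (_ + _).
by rewrite sum_shift /t /inner_vars iE.
Qed.

Lemma insertion_degree (v : {ffun 'I_p.+1 -> V}) (d : 'I_p.+1 -> int) :
  (forall j, gm_deg (d j) (v j)) ->
  vdeg (\sum_j d j + (n + m)) (insertion f g i v).
Proof.
move=> dv; rewrite insertionE.
case: fcs => _ _ fd; case: gcs => _ _ gd.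
pose D r := d (inord r).
have gdv : vdeg (\sum_(b < l.+1) D (i + b)%N + m) (g (inner_args l v i)).
  by apply: gd => b; rewrite ffunE; apply: dv.
apply: vdeg_vext gdv => x dx; apply: vdeg_vsubst.
set e := \sum_(b < _) _ + _ in dx.
have -> : \sum_j d j + (n + m) = \sum_(a < k.+1)
    (if (a < i)%N then D a else if (a == i :> nat)%N then e else D (a + l)%N) + n.
  rewrite -(big_mkord xpredT (fun a => if (a < i)%N then D a else
     if (a == i :> nat)%N then e else D (a + l)%N)) sum_block ?ltnS //.
  have -> : \sum_j d j = \sum_(0 <= r < k.+1 + l) D r.
    rewrite addSn -pE big_mkord; apply: eq_bigr => r _.
    by rewrite /D inord_val.
  rewrite (@sum_split _ D k.+1 l i) ?ltnS //.
  have -> : e = \sum_(i <= r < i + l.+1) D r + m.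
    by rewrite /e sum_shift.
  by rewrite !addrA [X in _ = X + _]addrAC [RHS]addrAC.
apply: fd => a; rewrite ffunE.
case: (_ < _)%N; first exact: dv.
by case: (_ == _ :> nat); [exact: dx | exact: dv].
Qed.

End AtI.

Lemma koszul_args_upd (e : int) i (v : {ffun 'I_p.+1 -> V}) j y :
  koszul_args e i (upd v j y) =
  upd (koszul_args e i v) j (if (j < i)%N then koszul e y else y).
Proof.
by apply/ffunP => a; rewrite !ffunE; case: (altP (a =P j)) => [->|].
Qed.

Lemma koszul_args_der (e : int) i (v : {ffun 'I_p.+1 -> V}) j :
  koszul_args e i (upd v j (∂ (v j))) =
  upd (koszul_args e i v) j (∂ (koszul_args e i v j)).
Proof.
rewrite koszul_args_upd; congr upd; rewrite ffunE.
by case: ifP => // _; rewrite koszul_der.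
Qed.

Lemma diamond_cs (e : int) :
  conformal_sesquilinear (n + m) (diamond e f g : cochain V p).
Proof.
split.
- move=> v j a x y; rewrite /diamond scaler_sumr -big_split.
  apply: eq_bigr => i _; rewrite !koszul_args_upd /=.
  have ik : (i <= k)%N by rewrite -ltnS.
  by case: ifP => _; rewrite ?koszulL (insertion_multilinear ik).
- split=> [v i j|v].
    rewrite /diamond scaler_sumr; apply: eq_bigr => r _.
    have rk : (r <= k)%N by rewrite -ltnS.
    by rewrite koszul_args_der (insertion_mid rk) /=.
  rewrite /diamond vder_sum scaler_sumr -big_split; apply: eq_bigr => r _.
  by rewrite koszul_args_der insertion_last // -ltnS.
- move=> d v dv; rewrite /diamond; apply: vdeg_sum => i.
  apply: insertion_degree; first by rewrite -ltnS.
  by move=> j; rewrite ffunE; case: ifP => _ //; apply: koszul_deg.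
Qed.

End Insert.

End InsertionTheory.

Section MultilinearTheory.
Context {K : fieldType} {V : gradedModule K}.

Lemma multilinearMz k n (phi : {ffun 'I_k -> V} -> vpoly V n) v i x z :
  multilinear phi -> phi (upd v i (x *~ z)) = phi (upd v i x) *~ z.
Proof.
move=> phiM; have phiK : klinear (fun y => phi (upd v i y)).
  by move=> a y y'; apply: phiM.
rewrite -scaler_int (klinearZ phiK).
by rewrite (rmorph_int (@mkmalgU _ K mone)) scaler_int.
Qed.

Lemma mulrz_sign (M : zmodType) (x : M) (a b : int) :
  x *~ (-1) ^ a *~ (-1) ^ b = x *~ (-1) ^ (a + b).
Proof. by rewrite -mulrzA exprzDr ?unitrN1. Qed.

Lemma diamond_homog p k l (n m : int) (f : cochain V k) (g : cochain V l)
    (d : 'I_p.+1 -> int) (v : {ffun 'I_p.+1 -> V}) :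
  p = (k + l)%N ->
  conformal_sesquilinear n f -> conformal_sesquilinear m g ->
  (forall j, gm_deg (d j) (v j)) ->
  diamond m f g v =
  \sum_(i < k.+1)
    insertion f g i v *~ (-1) ^ (m * \sum_(j < p.+1 | (j < i)%N) d j).
Proof.
move=> pE fcs gcs dv; apply: eq_bigr => i _.
have ik : (i <= k)%N by rewrite -ltnS.
have iM := insertion_multilinear pE fcs gcs ik.
suff E r : (r <= p.+1)%N -> insertion f g i (koszul_args m r v) =
    insertion f g i v *~ (-1) ^ (m * \sum_(j < p.+1 | (j < r)%N) d j).
  by apply: E; rewrite pE; lia.
elim: r => [_|r IH rp].
  rewrite big_pred0 ?mulr0 //; congr insertion.
  by apply/ffunP => j; rewrite ffunE.
have rE : (inord r : 'I_p.+1) = r :> nat by rewrite inordK.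
have -> : koszul_args m r.+1 v =
    upd (koszul_args m r v) (inord r) (v (inord r) *~ (-1) ^ (m * d (inord r))).
  apply/ffunP => j; rewrite !ffunE ltnS leq_eqVlt -val_eqE /= rE.
  case: eqP => [jr|//] /=.
  have -> : j = inord r by apply: val_inj; rewrite /= rE.
  exact: koszul_homog.
rewrite (multilinearMz _ _ _ _ iM).
have -> : upd (koszul_args m r v) (inord r) (v (inord r)) = koszul_args m r v.
  apply/ffunP => j; rewrite !ffunE; case: eqP => // ->.
  by rewrite rE ltnn.
rewrite (IH (ltnW rp)) mulrz_sign -mulrDr.
rewrite [X in _ = _ *~ (-1) ^ (m * X)](bigD1 (inord r)) /= ?rE // [in LHS]addrC.
congr (_ *~ (_ ^ (_ * (_ + _)))); apply: eq_bigl => j.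
by rewrite -val_eqE /= rE ltnS [RHS]andbC -ltn_neqAle.
Qed.

End MultilinearTheory.

(* Hom^n_cs(V^⊗(k+1), V[λ_0, ..., λ_(k-1)]) *)
Section HomCs.
Context {K : fieldType} (V : gradedModule K) (n : int) (k : nat).

Definition cs_pred : {pred cochain V k} :=
  fun phi => `[< conformal_sesquilinear n phi >].

Lemma cs_zmod_closed : zmod_closed cs_pred.
Proof.
split=> [|phi psi /asboolP[pM [p1 p2] pD] /asboolP[qM [q1 q2] qD]].
  apply/asboolP; split.
  - by move=> v i a x y; rewrite scaler0 addr0.
  - by split=> [v i i'|v]; rewrite ?vder0 scaler0 ?addr0.
  - by move=> d v _; apply: vdeg0.
apply/asboolP; have E v : (phi - psi) v = phi v - psi v by [].
have vderB (P Q : vpoly V k) : vder (P - Q) = vder P - vder Q.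
  by rewrite -scaleN1r vderD vderZ scaleN1r.
split.
- by move=> v i a x y; rewrite !E pM qM scalerBr opprD addrACA.
- split=> [v i i'|v]; first by rewrite !E p1 q1 scalerBr.
  by rewrite !E p2 q2 vderB scalerBr opprD addrACA.
- move=> d v dv; rewrite E; apply: vdegD; first exact: pD.
  by rewrite -scaleN1r; apply: vdegZ; apply: qD.
Qed.

HB.instance Definition _ :=
  GRing.isZmodClosed.Build (cochain V k) cs_pred cs_zmod_closed.

Record hom_cs : Type := HomCs {
  hom_cs_fun :> cochain V k;
  hom_cs_in : hom_cs_fun \in cs_pred
}.

HB.instance Definition _ := [isSub for hom_cs_fun].
HB.instance Definition _ := [Choice of hom_cs by <:].
HB.instance Definition _ := [SubChoice_isSubZmodule of hom_cs by <:].

Lemma hom_csP (phi : hom_cs) : conformal_sesquilinear n phi.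
Proof. by apply/asboolP; exact: (valP phi). Qed.

End HomCs.

(* C^n_cs(V), the product of the Hom^n_cs over all arities *)
Definition C_cs {K : fieldType} (V : gradedModule K) (n : int) : Type :=
  forall k : nat, hom_cs V n k.

Section CCs.
Context {K : fieldType} (V : gradedModule K) (n : int).
Implicit Types r s t : C_cs V n.

HB.instance Definition _ := gen_eqMixin (C_cs V n).
HB.instance Definition _ := gen_choiceMixin (C_cs V n).

Let zero : C_cs V n := fun=> 0.
Let opp r : C_cs V n := fun k => - r k.
Let add r s : C_cs V n := fun k => r k + s k.

Let addA : associative add.
Proof. by move=> r s t; apply/functional_extensionality_dep => k; apply: addrA. Qed.

Let addC : commutative add.
Proof. by move=> r s; apply/functional_extensionality_dep => k; apply: addrC. Qed.

Let add0 : left_id zero add.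
Proof. by move=> r; apply/functional_extensionality_dep => k; apply: add0r. Qed.

Let addN : left_inverse zero opp add.
Proof. by move=> r; apply/functional_extensionality_dep => k; apply: addNr. Qed.

HB.instance Definition _ :=
  GRing.isZmodule.Build (C_cs V n) addA addC add0 addN.

End CCs.

Section Bracket.
Context {K : fieldType} {V : gradedModule K} {n m : int}.
Variables (rho : C_cs V n) (sigma : C_cs V m).

Definition bracket_fun (p : nat) : cochain V p :=
  \sum_(k < p.+1)
    (diamond m (rho k) (sigma (p - k)%N)
     - diamond n (sigma (p - k)%N) (rho k) *~ (-1) ^ (m * n)).

Lemma bracket_in p : @bracket_fun p \in @cs_pred K V (n + m) p.
Proof.
apply: rpred_sum => k _; apply: rpredB.
  apply/asboolP; apply: (diamond_cs _ (hom_csP _) (hom_csP _)).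
  by rewrite subnKC // -ltnS.
apply: rpredMz; apply/asboolP; rewrite addrC.
apply: (diamond_cs _ (hom_csP _) (hom_csP _)).
by rewrite subnK // -ltnS.
Qed.

Definition bracket : C_cs V (n + m) := fun p => HomCs (bracket_in p).

End Bracket.

Definition maurer_cartan {K : fieldType} {V : gradedModule K}
    (rho : C_cs V (-1)) : Prop :=
  bracket rho rho = 0.

Definition Ainf1_conformal {K : fieldType} (V : gradedModule K)
    (rho : forall k, cochain V k) : Prop :=
  (forall k, conformal_sesquilinear (-1) (rho k)) /\
  (forall (n : nat) (d : 'I_n.+1 -> int) (v : {ffun 'I_n.+1 -> V}),
     (forall j, gm_deg (d j) (v j)) ->
     \sum_(k < n.+1) \sum_(i < k.+1)
       insertion (rho k) (rho (n - k)%N) i v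
         *~ (-1) ^ (\sum_(j < n.+1 | (j < i)%N) d j) = 0).

(* Main.v *)
(* For a cochain rho of degree -1 the sign (-1)^(mn) in the bracket is -1, so *)
(* the two halves of [[rho, rho]] agree after exchanging k and l: the bracket *)
(* is twice the sum of the rho_k ⋄ rho_l, whose values on homogeneous         *)
(* arguments are the left-hand sides of the A_infty[1]-relations. It remains  *)
(* to divide by 2, and to note that a multilinear map vanishes as soon as it  *)
(* does so on homogeneous arguments.                                          *)
Require Import Defs.
From mathcomp Require Import all_boot all_order all_algebra.
From mathcomp Require Import reals complex.
From mathcomp Require Import boolp functions.
From mathcomp.multinomials Require Import monalg.

Set Implicit Arguments.
Unset Strict Implicit.
Unset Printing Implicit Defensive.

Import GRing.Theory Num.Theory.
Local Open Scope ring_scope.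

(** In degree -1 the two halves of the bracket add up, so [[rho, rho]] is twice the sum
    [diamond_self] ([bracket_self]), which on homogeneous arguments is the left side of the
    relations ([diamond_self_homog]). The factor 2 is cancelled by [vpoly_mulr2n_eq0];
    [multilinear_homog_eq0] passes from homogeneous to arbitrary arguments. *)

Lemma exprN1zN (a : int) : (-1 : int) ^ (- a) = (-1) ^ a.
Proof. by rewrite -exprz_inv invrN1. Qed.

Section Char2Free.
Context {K : fieldType} {V : gradedModule K}.
Hypothesis two_neq0 : (2%:R : K) != 0.

Lemma vpoly_mulr2n_eq0 n (P : vpoly V n) : (P *+ 2 == 0) = (P == 0).
Proof.
apply/eqP/eqP => [P2|->]; last by rewrite mul0rn.
apply/malgP => m; have /(congr1 (fun Q : vpoly V n => Q@_m)) := P2.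
rewrite mcoeff0 mulr2n mcoeffD -mulr2n -scaler_nat => /eqP.
by rewrite scaler_eq0 (negbTE two_neq0) => /eqP.
Qed.

End Char2Free.

Section HomogeneousArguments.
Context {K : fieldType} {V : gradedModule K}.

(** Arguments are split into homogeneous components one at a time; the induction is on the number
    [r] of leading arguments that may be inhomogeneous. *)
Lemma multilinear_homog_eq0 k n (phi : {ffun 'I_k -> V} -> vpoly V n) :
  multilinear phi ->
  (forall (d : 'I_k -> int) (v : {ffun 'I_k -> V}),
     (forall j, gm_deg (d j) (v j)) -> phi v = 0) ->
  forall v, phi v = 0.
Proof.
move=> phiM phi0.
suff E r : (r <= k)%N -> forall (d : 'I_k -> int) (v : {ffun 'I_k -> V}),
    (forall j : 'I_k, (r <= j)%N -> gm_deg (d j) (v j)) -> phi v = 0.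
  (* At [r = k] no argument is constrained, so any degree function serves. *)
  move=> v; apply: (E k (leqnn k) (fun=> 0)) => j.
  by rewrite leqNgt ltn_ord.
elim: r => [_ d v dv|r IH rk d v dv]; first by apply: (phi0 d) => j; apply: dv.
pose i := Ordinal rk.
have phiK : klinear (fun y => phi (upd v i y)) by move=> a y y'; apply: phiM.
have -> : v = upd v i (v i).
  by apply/ffunP => j; rewrite ffunE; case: eqP => // ->.
rewrite (gm_componentsP (v i)).2.
rewrite (big_morph _ (klinearD phiK) (klinear0 phiK)).
rewrite big1 // => e _.
apply: (IH (ltnW rk) (fun j => if j == i then e else d j)) => j rj.
rewrite ffunE; case: eqP => [_|/eqP ji]; first exact: (gm_componentsP _).1.
apply: dv; rewrite ltn_neqAle rj andbT.
by move: ji; rewrite -val_eqE eq_sym.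
Qed.

(** The Koszul exponent is minus a sum of degrees, and only its parity matters. *)
Lemma diamond_homogN1 p k l (f : cochain V k) (g : cochain V l)
    (d : 'I_p.+1 -> int) (v : {ffun 'I_p.+1 -> V}) :
  p = (k + l)%N ->
  conformal_sesquilinear (-1) f -> conformal_sesquilinear (-1) g ->
  (forall j, gm_deg (d j) (v j)) ->
  diamond (-1) f g v =
  \sum_(i < k.+1)
    insertion f g i v *~ (-1) ^ (\sum_(j < p.+1 | (j < i)%N) d j).
Proof.
move=> pE fcs gcs dv; rewrite (diamond_homog pE fcs gcs dv).
by apply: eq_bigr => i _; rewrite mulN1r exprN1zN.
Qed.

End HomogeneousArguments.

Section MaurerCartan.
Context {K : fieldType} {V : gradedModule K}.
Variable rho : C_cs V (-1).

Definition diamond_self p : cochain V p :=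
  \sum_(k < p.+1) diamond (-1) (rho k) (rho (p - k)%N).
Arguments diamond_self : clear implicits.

Lemma bracket_self p :
  @bracket_fun _ _ _ _ rho rho p = diamond_self p *+ 2.
Proof.
pose F a b : cochain V p := diamond (-1) (rho a) (rho b).
rewrite /bracket_fun /diamond_self.
under eq_bigr => k _ do rewrite mulrNN mul1r expr1z mulrN1z opprK.
rewrite big_split /= mulr2n; congr (_ + _).
(* Indices are arities minus one and add up to [p], so the reversal of [k] swaps the two factors. *)
rewrite -/(\sum_(k < p.+1) F (p - k)%N k) (reindex_inj rev_ord_inj) /=.
by apply: eq_bigr => k _; rewrite subSS -/(F _ _) subKn // -ltnS.
Qed.

Lemma diamond_self_multilinear p : multilinear (diamond_self p).
Proof.
(* Each summand lies in the additive group of conformal sesquilinear maps of degree -2, hence so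
   does the sum. *)
suff /asboolP[] : diamond_self p \in @cs_pred K V (-1 + -1) p by [].
apply: rpred_sum => k _; apply/asboolP.
apply: (diamond_cs _ (hom_csP _) (hom_csP _)).
by rewrite subnKC // -ltnS.
Qed.

Lemma diamond_self_homog p (d : 'I_p.+1 -> int) (v : {ffun 'I_p.+1 -> V}) :
  (forall j, gm_deg (d j) (v j)) ->
  diamond_self p v =
  \sum_(k < p.+1) \sum_(i < k.+1)
    insertion (rho k) (rho (p - k)%N) i v
      *~ (-1) ^ (\sum_(j < p.+1 | (j < i)%N) d j).
Proof.
move=> dv.
have -> : diamond_self p v =
    \sum_(k < p.+1) diamond (-1) (rho k) (rho (p - k)%N) v.
  exact: (big_morph (fun f : cochain V p => f v)).
apply: eq_bigr => k _; apply: diamond_homogN1 dv; try exact: hom_csP.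
by rewrite subnKC // -ltnS.
Qed.

Lemma Ainf1_conformal_maurer_cartan : (2%:R : K) != 0 ->
  Ainf1_conformal (fun k => rho k : cochain V k) <-> maurer_cartan rho.
Proof.
move=> two_neq0; split=> [[_ rel]|mc].
  apply: functional_extensionality_dep => p; apply: val_inj.
  rewrite /= bracket_self; apply/funext => v.
  have -> : diamond_self p = 0; last by rewrite mul0rn.
  apply/funext; apply: multilinear_homog_eq0.
    exact: diamond_self_multilinear.
  by move=> d w dw; rewrite (diamond_self_homog dw); apply: rel.
split=> [k|p d v dv]; first exact: hom_csP.
rewrite -(diamond_self_homog dv); apply/eqP.
rewrite -(vpoly_mulr2n_eq0 two_neq0); apply/eqP.
have -> : diamond_self p v *+ 2 = (diamond_self p *+ 2) v by [].
have /(congr1 (fun s : C_cs V (-1 + -1) => (s p : cochain V p) v)) := mc.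
by rewrite /= bracket_self.
Qed.

End MaurerCartan.

Theorem theorem3p10 (R : realType) (V : gradedModule R[i])
    (rho : C_cs V (-1)) :
  Ainf1_conformal (fun k => rho k : cochain V k) <-> maurer_cartan rho.
Proof. by apply: Ainf1_conformal_maurer_cartan; rewrite pnatr_eq0. Qed.
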